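(* Let $\{D_I\}_{I\in\binom{[n]}{2}}$ be a family of positive real numbers satisfying the triangle inequalities. The family is polygonlike if and only if either it is snakelike, or it satisfies the following three conditions: (i) for every $i\in[n]$ there are exactly two elements $x,y\in[n]\setminus\{i\}$ such that $D_{i,x}$ and $D_{i,y}$ are indecomposable; (ii) the set $H$ produced by the renaming procedure below has cardinality $n$; (iii) after renaming the elements of $[n]$ by that procedure, for all $a<b$ in $[n]$, $$D_{a,b}=\min\Big\{\sum_{i=a}^{b-1}D_{i,i+1},\ \sum_{i=b}^{n-1}D_{i,i+1}+D_{1,n}+\sum_{i=1}^{a-1}D_{i,i+1}\Big\}.$$ Renaming procedure (defined when (i) holds): rename as $1$ and $2$ two elements with $D_{1,2}=\min D_{i,j}$, and set $H=\{1,2\}$; rename as $3$ the unique element of $[n]\setminus\{1,2\}$ such that $D_{2,3}$ is indecomposable and add $3$ to $H$; recursively, rename as $i+1$ the unique element of $[n]\setminus\{i-1,i\}$ such that $D_{i,i+1}$ is indecomposable; if it already belongs to $H$ stop, otherwise add it to $H$ and continue.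
   Context: Write $D_{i,j}=D_{\{i,j\}}$. Triangle inequalities: $D_{i,j}\le D_{i,k}+D_{k,j}$ for distinct $i,j,k$. $D_{i,j}$ is indecomposable if $D_{i,j}<D_{i,z}+D_{z,j}$ for all $z\in[n]\setminus\{i,j\}$. A positive-weighted graph $\mathcal G=(G,w)$ has $w:E(G)\to\mathbb R_{>0}$, and $D_{i,j}(\mathcal G)$ is the minimum total weight of a path from $i$ to $j$. A polygon with $n$ vertices is a graph whose vertices can be named $i_1,\dots,i_n$ with edges $e(i_1,i_2),\dots,e(i_{n-1},i_n),e(i_n,i_1)$; a snake is a tree with exactly two leaves. The family is polygonlike (resp. snakelike) if there is a positive-weighted polygon (resp. snake) $\mathcal G$ with vertex set $[n]$ such that $D_{i,j}(\mathcal G)=D_{i,j}$ for all distinct $i,j$. *)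

(* Defs.v *)
From HB Require Import structures.
From mathcomp Require Import all_boot all_order all_algebra all_fingroup reals.

Set Implicit Arguments.
Unset Strict Implicit.
Unset Printing Implicit Defensive.

Import Order.TTheory GRing.Theory Num.Theory.

Local Open Scope ring_scope.

(* The vertex set [n] is 'I_n, numbered from 0.  A family indexed by the      *)
(* 2-subsets of [n] is a function D on {set 'I_n} of which only the values at *)
(* sets of cardinality 2 matter; D_{i,j} is D [set i; j] with i != j.         *)

(* Finite simple graph on the vertex set 'I_n with positive edge weights.     *)
(* Only the values of wt at elements of edges matter.                         *)
Record wgraph (R : realType) (n : nat) := WGraph {
  edges : {set {set 'I_n}};
  wt : {set 'I_n} -> R;
  edges_card2 : forall e, e \in edges -> #|e| = 2%N;
  wt_gt0 : forall e, e \in edges -> 0 < wt e }.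

Section Graphs.
Context {R : realType} {n : nat}.
Implicit Types (G : wgraph R n) (i j : 'I_n) (p : seq 'I_n).

Definition adj G : rel 'I_n := [rel x y | [set x; y] \in edges G].

(* i :: p is the list of vertices of a path from i to j *)
Definition is_path G i j p : bool :=
  [&& path (adj G) i p, uniq (i :: p) & last i p == j].

Definition path_weight G i p : R :=
  \sum_(e <- pairmap (fun x y => [set x; y]) i p) wt G e.

Definition is_distance G i j (d : R) : Prop :=
  (exists2 p, is_path G i j p & path_weight G i p = d) /\
  (forall p, is_path G i j p -> d <= path_weight G i p).

(* ordS k is the cyclic successor of k in 'I_n.  For n = 2 this is the graph  *)
(* with a single edge; for n = 1 there is none, as edges have two endpoints.  *)
Definition is_polygon G : Prop :=
  exists v : {perm 'I_n}, edges G = [set [set v k; v (ordS k)] | k : 'I_n].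

Definition is_tree G : Prop :=
  (forall i j, connect (adj G) i j) /\
  (forall c, (2 < size c)%N -> ~ ucycle (adj G) c).

Definition is_leaf G i : bool := #|[set e in edges G | i \in e]| == 1%N.

Definition is_snake G : Prop :=
  is_tree G /\ #|[set i | is_leaf G i]| = 2%N.

End Graphs.

Section Families.
Context {R : realType} {n : nat}.
Variable D : {set 'I_n} -> R.
Implicit Types (i j p q u v : 'I_n) (s : seq 'I_n).

Definition realizes (G : wgraph R n) : Prop :=
  forall i j, i != j -> is_distance G i j (D [set i; j]).

Definition polygonlike : Prop := exists2 G, is_polygon G & realizes G.

Definition snakelike : Prop := exists2 G, is_snake G & realizes G.

Definition indecomposable i j : bool :=
  [forall z, (z != i) && (z != j) ==>
     (D [set i; j] < D [set i; z] + D [set z; j])].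

Definition indec_partners i : {set 'I_n} :=
  [set x | (x != i) && indecomposable i x].

Definition is_min_pair p q : Prop :=
  p != q /\ forall i j, i != j -> D [set p; q] <= D [set i; j].

Definition next_name u v : option 'I_n :=
  [pick z | [&& z != u, z != v & indecomposable v z]].

(* s lists the elements renamed so far, u and v being the last two.  Each     *)
(* round adds a new element of 'I_n, so n rounds always reach the stop.       *)
Fixpoint rename_rec (fuel : nat) s u v : seq 'I_n :=
  if fuel is fuel'.+1 then
    if next_name u v is Some z then
      if z \in s then s else rename_rec fuel' (rcons s z) v z
    else s
  else s.

(* The renamed elements in order of their new names: the element renamed as k *)
(* has index k - 1, the elements renamed as 1 and 2 being p and q.            *)
Definition renaming p q : seq 'I_n := rename_rec n [:: p; q] p q.

Definition renamed_set p q : {set 'I_n} := [set x in renaming p q].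

(* D_{a,b} after renaming, with the new names counted from 0 *)
Definition renamed_family p q (a b : nat) : R :=
  D [set nth p (renaming p q) a; nth p (renaming p q) b].

End Families.

(* Main.v *)
(**
A graph realizes D as soon as D e <= w(e) on its edges and every D_{i,j} is
attained by a path: the lower bound on other paths is the triangle inequality.
So one may always take w = D.

A snake is a Hamiltonian path without chords, hence a subgraph of a polygon;
closing it up with the edge of weight D realizes the same family.

In a polygon, D_{i,j} is the shorter of the two arcs.  If some edge weighs at
least as much as all the others together, deleting it leaves a snake with the
same distances.  Otherwise the indecomposable pairs are exactly the edges, the
pair of minimal value is an edge, and the renaming walks around the polygon.
Conversely (ii) makes the renaming a cyclic ordering of [n], and (iii) says that
the polygon on this ordering with w = D realizes D.
*)

Require Import Defs.
From mathcomp Require Import all_boot all_order all_algebra all_fingroup reals.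
From mathcomp Require Import zify lra.

Set Implicit Arguments.
Unset Strict Implicit.
Unset Printing Implicit Defensive.

Import Order.TTheory GRing.Theory Num.Theory.

Local Open Scope ring_scope.

Lemma set2_inj (T : finType) (x y a b : T) :
  [set x; y] = [set a; b] -> (x = a /\ y = b) \/ (x = b /\ y = a).
Proof.
move=> E.
have := set21 x y; rewrite E !inE => /orP [] /eqP xE.
  have := set22 x y; rewrite E !inE => /orP [] /eqP yE; last by left.
  by have := set22 a b; rewrite -E !inE xE yE orbb => /eqP ->; left.
have := set22 x y; rewrite E !inE => /orP [] /eqP yE; first by right.
by have := set21 a b; rewrite -E !inE xE yE orbb => /eqP ->; right.
Qed.

(** * Snakes are Hamiltonian paths *)

Section Graph.
Context {R : realType} {n : nat}.
Implicit Types (G : wgraph R n) (x y z : 'I_n) (p s : seq 'I_n).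

Lemma adjC G x y : adj G x y = adj G y x.
Proof. by rewrite /adj /= setUC. Qed.

Lemma adj_neq G x y : adj G x y -> x != y.
Proof.
by move=> /edges_card2; rewrite cards2; case: eqP.
Qed.

Lemma path_weight_nil G x : path_weight G x [::] = 0.
Proof. by rewrite /path_weight big_nil. Qed.

Lemma path_weight_cons G x y p :
  path_weight G x (y :: p) = wt G [set x; y] + path_weight G y p.
Proof. by rewrite /path_weight /= big_cons. Qed.

Lemma path_weight_rcons G x p y :
  path_weight G x (rcons p y) = path_weight G x p + wt G [set last x p; y].
Proof.
elim: p x => [|z p IH] x /=.
  by rewrite path_weight_cons !path_weight_nil addrC.
by rewrite !path_weight_cons IH addrA.
Qed.

Lemma path_weight_rev G x p :
  path_weight G (last x p) (rev (belast x p)) = path_weight G x p.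
Proof.
elim: p x => [|y p IH] x //=.
rewrite rev_cons path_weight_rcons path_weight_cons IH addrC; congr (wt G _ + _).
suff -> : last (last y p) (rev (belast y p)) = y by rewrite setUC.
by case: p {IH} => //= z p; rewrite rev_cons last_rcons.
Qed.

Lemma is_path_rev G x y p :
  is_path G x y p -> is_path G y x (rev (belast x p)).
Proof.
move=> /and3P [pth u /eqP <-]; apply/and3P; split.
- by rewrite rev_path; apply: sub_path pth => a b; rewrite adjC.
- by rewrite -rev_rcons -lastI rev_uniq.
- by case: p {pth u} => //= z p; rewrite rev_cons last_rcons.
Qed.

(** A 1-Lipschitz function on the vertices bounds path weights from below. All lower bounds on
    distances come from this, with different choices of [f]. *)
Lemma potential_le G (f : 'I_n -> R) x p :
    (forall y z, adj G y z -> f z <= f y + wt G [set y; z]) ->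
  path (adj G) x p -> f (last x p) <= f x + path_weight G x p.
Proof.
move=> lip; elim: p x => [|y p IH] x /=; first by rewrite path_weight_nil addr0.
move=> /andP [xy /IH /le_trans]; apply.
by rewrite path_weight_cons addrA lerD2r lip.
Qed.

Lemma is_leafP G x :
  reflect (exists2 y, adj G x y & forall z, adj G x z -> z = y) (is_leaf G x).
Proof.
apply: (iffP cards1P) => [[e eE]|[y xy yu]].
  have : e \in [set e] by rewrite inE.
  rewrite -eE inE => /andP [eG xe].
  have /cards2P [a [b [_ eab]]] : #|e| == 2%N by rewrite (edges_card2 eG).
  have [y exy] : exists y, e = [set x; y].
    move: xe; rewrite eab !inE => /orP [] /eqP ->; first by exists b.
    by exists a; rewrite setUC.
  exists y; first by rewrite /adj /= -exy.
  move=> z xz.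
  have : [set x; z] \in [set e] by rewrite -eE !inE eqxx andbT.
  rewrite inE exy => /eqP /set2_inj [[_ ->]|[xy _]] //.
  by move: (edges_card2 eG); rewrite exy xy setUid cards1.
exists [set x; y]; apply/setP => e; rewrite !inE.
apply/andP/eqP => [[eG xe]|->]; last by rewrite set21.
have /cards2P [a [b [_ eab]]] : #|e| == 2%N by rewrite (edges_card2 eG).
move: xe eG; rewrite eab !inE => /orP [] /eqP <-; first by move=> /yu ->.
by rewrite setUC => /yu ->.
Qed.

(** Induction on the number of vertices off the path: a path without repetition has at most [n]
    vertices, so adding neighbours at its end must stop. *)
Lemma extend_to_maximal_path G x p :
    path (adj G) x p -> uniq (x :: p) ->
  exists s, [/\ path (adj G) x (p ++ s), uniq (x :: p ++ s)
    & forall y, adj G (last x (p ++ s)) y -> y \in x :: p ++ s].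
Proof.
have [m] := ubnP (n - size (x :: p))%N.
elim: m p => // m IH p lem pth u.
have [[y yadj yN]|max] : (exists2 y, adj G (last x p) y & y \notin x :: p) \/
    (forall y, adj G (last x p) y -> y \in x :: p).
- case: (pickP [pred y | adj G (last x p) y && (y \notin x :: p)]) => [y /andP [? ?]|H].
    by left; exists y.
  by right=> y ya; have /= := H y; rewrite ya /= => /negbFE.
- have uy : uniq (x :: rcons p y) by rewrite -rcons_cons rcons_uniq yN.
  have szy : (size (x :: rcons p y) <= n)%N.
    by rewrite -(card_uniqP uy) -[leqRHS]card_ord max_card.
  have [||s H] := IH (rcons p y) _ _ uy.
  + by move: lem szy; rewrite /= size_rcons; lia.
  + by rewrite rcons_path pth.
  by exists (y :: s); rewrite -cat_rcons.
- by exists [::]; rewrite cats0.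
Qed.

Definition acyclic G := forall c, (2 < size c)%N -> ~ ucycle (adj G) c.

(** If [y] came before the predecessor of [z], the stretch of the path from [y] to [z] and the edge
    back to [y] would form a cycle of length at least 3. *)
Lemma acyclic_chord G x p z y :
    acyclic G -> path (adj G) x (rcons p z) -> uniq (x :: rcons p z) ->
  y \in x :: p -> adj G z y -> y = last x p.
Proof.
move=> ac pth u yp; case/splitPl: yp pth u => p1 p2 <-.
case: p2 => [|t p2]; first by rewrite cats0.
rewrite rcons_cat cat_path -cat_cons cat_uniq => /andP [_ pth] /and3P [u1 H u2] zy.
case: (ac (last x p1 :: rcons (t :: p2) z)); first by rewrite /= size_rcons.
rewrite /ucycle [uniq _]cons_uniq u2 andbT.
have -> : path.cycle (adj G) (last x p1 :: rcons (t :: p2) z) =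
    path (adj G) (last x p1) (rcons (rcons (t :: p2) z) (last x p1)) by [].
rewrite rcons_path pth last_rcons zy /=.
by apply: contra H => H; apply/hasP; exists (last x p1) => //; rewrite mem_last.
Qed.

(* Two paths from [u] that diverge and meet again close up into a cycle. *)
Lemma acyclic_theta G u y p s :
    acyclic G -> path (adj G) u p -> uniq (u :: p) ->
    path (adj G) u (y :: s) -> uniq (u :: y :: s) ->
  y \notin p -> has (mem p) s -> False.
Proof.
move=> ac pp up ps us yp hs; case/split_find: hs ps us => w s1 s2 /= wp Ns1 ps us.
move: pp up yp Ns1; case/path.splitP: wp => p1 p2 pp up yp Ns1.
(* The cycle follows [p] from [u] to [w], the first vertex of [s] on [p], then returns to [u]
   backwards through [s1] and [y]. *)
have Dperm : perm_eq (u :: (rcons p1 w) ++ rev (y :: s1)) ((u :: rcons p1 w) ++ y :: s1).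
  by rewrite -cat_cons perm_cat2l perm_rev.
apply: (ac (u :: (rcons p1 w) ++ rev (y :: s1))).
  by rewrite /= size_cat size_rcons size_rev /=; lia.
rewrite /ucycle (perm_uniq Dperm) cat_uniq; apply/andP; split; last first.
  apply/and3P; split.
  - by move: up; rewrite -cat_cons cat_uniq => /andP [].
  - apply/hasPn => t ts; apply/negP => tp.
    have tu : t != u.
      move: us => /andP [uN _]; apply: contraNneq uN => <-; move: ts.
      by rewrite !inE mem_cat mem_rcons !inE => /orP [->|->] //; rewrite !orbT.
    have {}tp : t \in rcons p1 w ++ p2.
      by move: tp; rewrite inE (negPf tu) mem_cat /= => ->.
    move: ts; rewrite inE => /orP [/eqP ty|ts]; first by rewrite -ty tp in yp.
    by move/hasPn: Ns1 => /(_ t ts) /=; rewrite tp.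
  - move: us; rewrite cons_uniq cat_rcons -cat_cons cat_uniq => /and3P [_ + /and3P [+ _ _]] /=.
    by rewrite mem_cat negb_or => /andP [-> _].
rewrite [path.cycle]lock /= -lock /path.cycle rcons_cat cat_path last_rcons.
move: pp; rewrite cat_path => /andP [-> _] /=.
have : path (adj G) u (rcons (y :: s1) w).
  by move: ps; rewrite /= cat_path => /and3P [-> -> _].
move=> ps1; have := rev_path (adj G) u (rcons (y :: s1) w).
rewrite last_rcons belast_rcons rev_cons => ->.
by apply: sub_path ps1 => a b; rewrite adjC.
Qed.

(** By maximality every neighbour of the end lies on the path, and by [acyclic_chord] it can only be
    the predecessor. *)
Lemma maximal_path_leaf G x p :
    acyclic G -> path (adj G) x p -> uniq (x :: p) -> p != [::] ->
    (forall y, adj G (last x p) y -> y \in x :: p) ->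
  is_leaf G (last x p) /\ last x p != x.
Proof.
move=> ac; case/lastP: p => // p z pth u _; rewrite last_rcons => max.
split; last first.
  by move: u; rewrite cons_uniq mem_rcons inE negb_or eq_sym => /andP [/andP []].
apply/is_leafP; exists (last x p).
  by move: pth; rewrite rcons_path adjC => /andP [].
move=> y zy; apply: (acyclic_chord ac pth u) => //.
have := max _ zy; rewrite inE mem_rcons inE inE (eq_sym y z) (negPf (adj_neq zy)) /=.
by [].
Qed.

Lemma snake_hamiltonian_path G : is_snake G ->
  exists x p, [/\ path (adj G) x p, uniq (x :: p) & forall y, y \in x :: p].
Proof.
move=> [[conn ac] /eqP leaves].
have [a aL] : exists a, a \in [set i | is_leaf G i].
  by apply/card_gt0P; rewrite (eqP leaves).
move: (aL); rewrite inE => /is_leafP [b ab _].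
have [||s] := @extend_to_maximal_path G a [:: b].
- by rewrite /= andbT.
- by rewrite /= inE andbT (adj_neq ab).
rewrite cat1s; set p := b :: s; move=> [pth u max].
have [zL za] := maximal_path_leaf ac pth u isT max.
(* The two leaves are [a] and the end of the maximal path. *)
have only z : is_leaf G z -> z != a -> z = last a p.
  move=> zl zNa.
  have sub : [set a; last a p] \subset [set i | is_leaf G i].
    by apply/subsetP => t; rewrite !inE => /orP [] /eqP -> //; move: aL; rewrite inE.
  have E : [set a; last a p] = [set i | is_leaf G i].
    by apply/eqP; rewrite eqEcard sub (eqP leaves) cards2 eq_sym za.
  by move: zl; rewrite -[is_leaf G z]in_set -E !inE (negPf zNa) /= => /eqP.
exists a, p; split=> // t.
(* A branch [d] off the path, extended maximally from [a], would end in a leaf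
   as well, hence in the same leaf, and close a cycle. *)
have step c d : adj G c d -> c \in a :: p -> d \in a :: p.
  move=> cd cp; case: (boolP (d \in a :: p)) => // dN; exfalso.
  have [p1 [p2 [pE cE]]] : exists p1 p2, p = p1 ++ p2 /\ c = last a p1.
    by case/splitPl: cp => p1 p2 <-; exists p1, p2.
  move: pth u dN; rewrite pE cat_path -cE -cat_cons cat_uniq => /andP [pth1 pth2].
  move=> /and3P [u1 /hasPn u12 u2] dN.
  have [||r] := @extend_to_maximal_path G a (rcons p1 d).
  - by rewrite rcons_path pth1 -cE.
  - rewrite -rcons_cons rcons_uniq u1 andbT.
    by apply: contra dN; rewrite mem_cat => ->.
  move=> [pthr ur maxr].
  have [|rL ra] := maximal_path_leaf ac pthr ur _ maxr; first by case: (p1).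
  have lastr := only _ rL ra.
  move: pthr ur lastr; rewrite cat_rcons cat_path -cE -cat_cons cat_uniq.
  move=> /andP [_ pthr] /and3P [_ /hasPn u1r ur] lastr.
  have uc s' : uniq s' -> {in s', forall x, x \notin a :: p1} -> uniq (c :: s').
    by move=> us H; rewrite /= us andbT; apply/negP => /H; rewrite cE mem_last.
  (* If the branch left from the end of [p], maximality of [p] would already put [d] on it. *)
  have p2N : p2 != [::].
    by apply: contraNneq dN => p2E; rewrite cat_cons -pE; apply: max; rewrite pE p2E cats0 -cE.
  apply: (acyclic_theta ac pth2 (uc _ u2 u12) pthr (uc _ ur u1r)).
    by apply: contra dN; rewrite mem_cat => ->; rewrite orbT.
  have lp2 : last a p \in p2.
    by rewrite pE last_cat; case: (p2) p2N => //= t' ? _; rewrite mem_last.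
  apply/hasP; exists (last a p) => //.
  have : last a p \in d :: r by rewrite -lastr last_cat /= mem_last.
  rewrite inE => /orP [/eqP lE|//].
  by rewrite mem_cat -lE lp2 orbT in dN.
(* The path is closed under adjacency, so connectedness makes it contain every vertex. *)
rewrite -(@closed_connect _ (adj G) (mem (a :: p)) _ a t) //; first exact: mem_head.
move=> c d cd; apply/idP/idP; first exact: step.
by apply: step; rewrite adjC.
Qed.

End Graph.

(** * Realizing a metric by a graph *)

Section Realization.
Context {R : realType} {n : nat} {D : {set 'I_n} -> R}.
Implicit Types (G H : wgraph R n) (x y z : 'I_n).

Lemma realizes_edge_le G (e : {set 'I_n}) : realizes D G -> e \in edges G -> D e <= wt G e.
Proof.
move=> rG eG.
have /cards2P [x [y [xy eE]]] : #|e| == 2%N by rewrite (edges_card2 eG).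
have [_ /(_ [:: y])] := rG _ _ xy.
rewrite path_weight_cons path_weight_nil addr0 -eE; apply.
by rewrite /is_path /= inE xy eqxx !andbT /adj /= -eE.
Qed.

Context (D_gt0 : forall I : {set 'I_n}, #|I| = 2%N -> 0 < D I).
Context (D_triangle : forall i j k : 'I_n, i != j -> i != k -> j != k ->
  D [set i; j] <= D [set i; k] + D [set k; j]).

Lemma D_le_path_weight G :
    (forall e, e \in edges G -> D e <= wt G e) ->
  forall i j p, i != j -> is_path G i j p -> D [set i; j] <= path_weight G i p.
Proof.
move=> DG i j p ij /and3P [pth _ /eqP lp].
(* The potential is the distance from [i]. Its value at [i] is set by hand, as [D] is a distance
   only on sets of two elements. *)
pose f x := if x == i then 0 else D [set i; x].
suff /potential_le /(_ pth) : forall y z, adj G y z -> f z <= f y + wt G [set y; z].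
  by rewrite lp /f eqxx eq_sym (negPf ij) add0r.
move=> y z yz; have yNz := adj_neq yz; have Dyz := DG _ yz; have wyz := wt_gt0 yz.
rewrite /f; have [zi|zi] := eqVneq z i; have [yi|yi] := eqVneq y i.
- by rewrite add0r ltW.
- by rewrite addr_ge0 ?ltW // D_gt0 // cards2 eq_sym yi.
- by rewrite add0r -yi.
- apply: le_trans (_ : D [set i; y] + D [set y; z] <= _); last by rewrite lerD2l.
  by apply: D_triangle; rewrite 1?eq_sym // eq_sym.
Qed.

Lemma realizes_of_paths G :
    (forall e, e \in edges G -> D e <= wt G e) ->
    (forall i j, i != j ->
       exists2 p, is_path G i j p & path_weight G i p <= D [set i; j]) ->
  realizes D G.
Proof.
move=> DG short i j ij; have le_path := D_le_path_weight DG ij.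
split; last by move=> p /le_path.
have [p pp pw] := short _ _ ij; exists p => //.
by apply/eqP; rewrite eq_le pw le_path.
Qed.

Definition metric_graph (E : {set {set 'I_n}}) (E2 : forall e, e \in E -> #|e| = 2%N) :
  wgraph R n := WGraph E2 (fun e eE => D_gt0 (E2 e eE)).

Lemma metric_graph_realizes E E2 :
    (forall i j, i != j ->
      exists2 p, is_path (@metric_graph E E2) i j p
        & path_weight (metric_graph E2) i p <= D [set i; j]) ->
  realizes D (metric_graph E2).
Proof. by apply: realizes_of_paths => e _. Qed.

(** A shortest path of [G] survives in the larger graph, and replacing weights by [D] cannot make it
    heavier. *)
Lemma subgraph_realizes G (E : {set {set 'I_n}}) (E2 : forall e, e \in E -> #|e| = 2%N) :
  realizes D G -> edges G \subset E -> realizes D (metric_graph E2).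
Proof.
move=> rG /subsetP GE; apply: metric_graph_realizes => i j ij.
have [[p /and3P [pth up lp] <-] _] := rG _ _ ij; exists p.
  by apply/and3P; split=> //; apply: sub_path pth => x y; apply: GE.
elim: p i pth {ij up lp} => [|y p IH] x; first by rewrite !path_weight_nil.
move=> /andP [xy pth]; rewrite !path_weight_cons lerD ?IH //=.
exact: realizes_edge_le xy.
Qed.

(** If a shortest path from [x] to [y] first visits some [z] other than [y], it shows that [D] at
    [x], [y] is at least the sum through [z]. *)
Lemma indecomposable_adj G x y : realizes D G -> x != y -> indecomposable D x y -> adj G x y.
Proof.
move=> rG xy ind; have [[p pp pw] _] := rG _ _ xy.
case: p pp pw => [|z p] /and3P [/= pth u /eqP l] pw; first by rewrite l eqxx in xy.
move: pth u => /andP [xz pth] /andP [xN u].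
have [zy|zy] := eqVneq z y; first by rewrite -zy.
have xNz := adj_neq xz.
move: ind => /forallP /(_ z) /implyP; rewrite eq_sym xNz zy => /(_ isT).
rewrite -pw path_weight_cons ltNge lerD //; first exact: realizes_edge_le.
by have [_] := rG _ _ zy; apply; apply/and3P; rewrite l.
Qed.

End Realization.

Lemma window_path (R : realType) n (G : wgraph R n) (u : nat -> 'I_n) (a b : nat) :
    (a <= b)%N ->
    (forall i, (a <= i < b)%N -> adj G (u i) (u i.+1)) ->
    (forall i j, (a <= i <= b)%N -> (a <= j <= b)%N -> u i = u j -> i = j) ->
  exists2 p, is_path G (u a) (u b) p
    & path_weight G (u a) p = \sum_(a <= i < b) wt G [set u i; u i.+1].
Proof.
move=> ab; rewrite -(subnKC ab); move: (b - a)%N => k {b ab} ad inj.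
have U : uniq [seq u i | i <- iota a k.+1].
  rewrite map_inj_in_uniq ?iota_uniq // => i j; rewrite !mem_iota => ia ja.
  by apply: inj; lia.
exists [seq u i | i <- iota a.+1 k].
  apply/and3P; split=> //.
    elim: k a ad {inj U} => //= k IH a ad; rewrite ad ?IH //; last by lia.
    by move=> i H; apply: ad; lia.
  rewrite last_map; apply/eqP; congr (u _).
  by elim: k a {U ad inj} => [|k IH] a /=; rewrite ?addn0 // IH addSnnS.
elim: k a {ad inj U} => [|k IH] a; first by rewrite addn0 big_geq // path_weight_nil.
by rewrite /= path_weight_cons IH addSnnS [RHS]big_ltn // addnS ltnS leq_addr.
Qed.

(** * Polygons and their distances *)

Section Polygon.
Context {m : nat}.
Local Notation N := m.+2.
Implicit Types (v : {perm 'I_N}).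

Definition polygon_edges v : {set {set 'I_N}} := [set [set v k; v (ordS k)] | k : 'I_N].

(* The vertices of the polygon, read cyclically: the index is taken modulo [N]. *)
Definition vtx v (i : nat) : 'I_N := v (inZp i).

Lemma vtx_val v (k : 'I_N) : vtx v k = v k.
Proof. by rewrite /vtx valZpK. Qed.

Lemma ordS_inZp i : ordS (inZp i : 'I_N) = inZp i.+1.
Proof. by apply/val_inj; rewrite /= -addn1 modnDml addn1. Qed.

Lemma vtx_period v i : vtx v (i + N) = vtx v i.
Proof. by congr (v _); apply/val_inj; rewrite /= modnDr. Qed.

(** A window of at most [N] consecutive indices meets each residue modulo [N] at most once. *)
Lemma vtx_inj v a b i j : (b < a + N)%N ->
  (a <= i <= b)%N -> (a <= j <= b)%N -> vtx v i = vtx v j -> i = j.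
Proof.
move=> ab ia ja /perm_inj /(congr1 val) /= /eqP E.
wlog ij : i j ia ja E / (i <= j)%N.
  by move=> W; case: (leqP i j) => [|/ltnW] ij; [|symmetry]; apply: W; rewrite // eq_sym.
move: E; rewrite eq_sym eqn_mod_dvd // => /dvdn_leq; lia.
Qed.

Lemma vtx_edge v i : [set vtx v i; vtx v i.+1] \in polygon_edges v.
Proof. by apply/imsetP; exists (inZp i); rewrite // ordS_inZp. Qed.

Lemma polygon_edgesP v e : e \in polygon_edges v ->
  exists2 i, (i < N)%N & e = [set vtx v i; vtx v i.+1].
Proof.
by move=> /imsetP [k _ ->]; exists k => //; rewrite vtx_val /vtx -ordS_inZp valZpK.
Qed.

Lemma polygon_edges_card2 v e : e \in polygon_edges v -> #|e| = 2%N.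
Proof.
move=> /polygon_edgesP [i _ ->]; rewrite cards2.
case: eqP => // /(@vtx_inj v i i.+1); lia.
Qed.

Lemma polygon_edges_rot v : polygon_edges (perm (@ordS_inj N) * v)%g = polygon_edges v.
Proof.
apply/setP => e; apply/imsetP/imsetP => [] [k _ ->].
  by exists (ordS k); rewrite // !permM !permE.
by exists (ord_pred k); rewrite // !permM !permE ord_predK.
Qed.

Lemma ordS_rev (k : 'I_N) : ordS (rev_ord (ordS k)) = rev_ord k.
Proof.
case: k => k kN; apply: val_inj => /=.
have [kE|kE] := eqVneq k m.+1; first by rewrite kE modnn subSS subn0 modnn subnn.
by rewrite !modn_small; lia.
Qed.

Lemma polygon_edges_flip v : polygon_edges (perm (@rev_ord_inj N) * v)%g = polygon_edges v.
Proof.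
apply/setP => e; apply/imsetP/imsetP => [] [k _ ->]; exists (rev_ord (ordS k)) => //.
  by rewrite !permM !permE ordS_rev setUC.
by rewrite !permM !permE ordS_rev rev_ordK setUC rev_ordK.
Qed.

(** Rotations and the reflection act transitively on oriented edges, so any edge can be moved to
    position [t] in either direction without changing the polygon. *)
Lemma polygon_basepoint v (t x y : 'I_N) : [set x; y] \in polygon_edges v ->
  exists v', [/\ polygon_edges v' = polygon_edges v, v' t = x & v' (ordS t) = y].
Proof.
have main v0 k : exists v', [/\ polygon_edges v' = polygon_edges v0, v' t = v0 k
    & v' (ordS t) = v0 (ordS k)].
  pose r := perm (@ordS_inj N).
  have rX c i : (r ^+ c)%g (inZp i) = inZp (i + c).
    elim: c => [|c IH]; first by rewrite expg0 perm1 addn0.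
    by rewrite expgSr permM IH permE ordS_inZp addnS.
  (* The rotation is by [k - t] modulo [N]; adding [N] avoids truncated subtraction. *)
  have [c tk] : exists c, (t + c = k + N)%N.
    by exists (k + (N - t))%N; have := ltn_ord t; lia.
  exists (r ^+ c * v0)%g; split.
  - elim: c {tk} => [|c IH]; first by rewrite expg0 mul1g.
    by rewrite expgS -mulgA polygon_edges_rot.
  - rewrite permM -[in LHS](valZpK t) rX; congr (v0 _); apply: val_inj => /=.
    by rewrite tk modnDr modn_small.
  - rewrite permM -[in LHS](valZpK t) ordS_inZp rX; congr (v0 _); apply: val_inj => /=.
    by rewrite addSn tk -addSn modnDr.
move=> /imsetP [k _ /set2_inj [] [-> ->]]; first exact: main.
(* The edge is wanted in the reverse direction: reflect first, then rotate. *)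
rewrite -polygon_edges_flip.
have [v' [E e1 e2]] := main (perm (@rev_ord_inj N) * v)%g (rev_ord (ordS k)).
by exists v'; rewrite e1 e2 !permM !permE ordS_rev !rev_ordK.
Qed.

End Polygon.

(** * Distance on a circle *)

Lemma min_cases (R : realType) (a b : R) :
  (Num.min a b = a /\ a <= b) \/ (Num.min a b = b /\ b <= a).
Proof. by case: (leP a b) => ab; [left|right; rewrite ltW]. Qed.

(** Distance between the points at arc lengths [A] and [B] on a circle of circumference [W]. *)
Definition circle_dist (R : realType) (W A B : R) : R :=
  Num.min `|A - B| (W - `|A - B|).

(** Moving a point by [w] along the circle changes its distance to a fixed point by at most [w]:
    this is the Lipschitz condition for the potential. *)
Lemma circle_dist_step (R : realType) (W A B w : R) :
    0 <= A <= W -> 0 <= B -> 0 <= w -> B + w <= W ->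
  circle_dist W A (B + w) <= circle_dist W A B + w /\
  circle_dist W A B <= circle_dist W A (B + w) + w.
Proof.
move=> /andP [A0 AW] B0 w0 BW; rewrite /circle_dist.
by split; case: ger0P => ?; case: ger0P => ?;
  repeat match goal with |- context [Num.min ?a ?b] =>
    case: (min_cases a b) => -[-> ?] end; lra.
Qed.

(** Arc lengths [0] and [W] name the same point; the edge closing the polygon needs this. *)
Lemma circle_dist_wrap (R : realType) (W A : R) :
  0 <= A <= W -> circle_dist W A W = circle_dist W A 0.
Proof.
move=> /andP [A0 AW]; rewrite /circle_dist subr0 ler0_norm ?subr_le0 // ger0_norm // minC.
by congr Num.min; lra.
Qed.

Section Distances.
Context {R : realType} {m : nat}.
Local Notation N := m.+2.
Implicit Types (G : wgraph R N) (v : {perm 'I_N}) (x y z : 'I_N).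

Lemma vtx_surj v x : exists2 a, (a < N)%N & x = vtx v a.
Proof. by exists (v^-1 x)%g => //; rewrite vtx_val permKV. Qed.

Lemma vtx_neq_sym (P : 'I_N -> 'I_N -> Prop) v :
    (forall x y, P x y -> P y x) ->
    (forall a b, (a < b < N)%N -> P (vtx v a) (vtx v b)) ->
  forall x y, x != y -> P x y.
Proof.
move=> Psym Plt x y; have [a aN ->] := vtx_surj v x; have [b bN ->] := vtx_surj v y.
have [ab _|ba _|-> /eqP //] := ltngtP a b; first by apply: Plt; rewrite ab.
by apply/Psym/Plt; rewrite ba.
Qed.

(** Since [b] may exceed [N], this covers both arcs between two vertices, including the one passing
    through index [0]. *)
Lemma arc_path G v a b : {subset polygon_edges v <= edges G} -> (a <= b < a + N)%N ->
  exists2 p, is_path G (vtx v a) (vtx v b) p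
    & path_weight G (vtx v a) p = \sum_(a <= i < b) wt G [set vtx v i; vtx v i.+1].
Proof.
move=> vG /andP [ab bN]; apply: window_path => // [i _|i j].
  by apply: vG; apply: vtx_edge.
exact: vtx_inj.
Qed.

Lemma ex_path_rev G x y (P : R -> Prop) :
    (exists2 p, is_path G x y p & P (path_weight G x p)) ->
  exists2 p, is_path G y x p & P (path_weight G y p).
Proof.
case=> p pp Pp; exists (rev (belast x p)); first exact: is_path_rev.
by case/and3P: (pp) => _ _ /eqP <-; rewrite path_weight_rev.
Qed.

Lemma sum_arc_wrap (w : nat -> R) a b : (forall i, w (i + N) = w i) -> (b < N)%N ->
  \sum_(b <= i < a + N) w i = \sum_(b <= i < N) w i + \sum_(0 <= i < a) w i.
Proof.
move=> wN bN; rewrite (@big_cat_nat _ _ _ N) ?leq_addl ?(ltnW bN) //=.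
by congr (_ + _); rewrite -{1}[N]add0n big_addn addnK; apply: eq_bigr => i _.
Qed.

(** Both arcs are paths, so neither is shorter than [D]. Conversely a potential along a shortest
    path shows that it weighs at least the smaller arc. *)
Lemma polygon_distance (D : {set 'I_N} -> R) G v a b :
    edges G = polygon_edges v -> realizes D G -> (a < b < N)%N ->
  let w i := wt G [set vtx v i; vtx v i.+1] in
  D [set vtx v a; vtx v b] =
    Num.min (\sum_(a <= i < b) w i) (\sum_(b <= i < a + N) w i).
Proof.
move=> Gv rG /andP [ab bN] w.
have w_gt0 i : 0 < w i by apply: wt_gt0; rewrite Gv; apply: vtx_edge.
have wN i : w (i + N) = w i by rewrite /w -addSn !vtx_period.
have vG : {subset polygon_edges v <= edges G} by rewrite Gv.
have uab : vtx v a != vtx v b by apply/eqP => /(@vtx_inj _ v 0%N b); lia.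
have [[p pp pw] le_path] := rG _ _ uab.
apply/eqP; rewrite eq_le le_min; apply/andP; split.
  apply/andP; split.
    by have [|p' pp' <-] := @arc_path G v a b vG; [lia|apply: le_path].
  have [|p' pp' p'w] := @arc_path G v b (a + N) vG; first by lia.
  rewrite vtx_period in pp'.
  have [|p'' pp''] := @ex_path_rev G (vtx v b) (vtx v a)
    (fun r => r = \sum_(b <= i < a + N) w i); first by exists p'.
  by move=> <-; apply: le_path.
pose s c := \sum_(0 <= i < c) w i.
have sS c : s c.+1 = s c + w c by rewrite /s big_nat_recr.
have s_mono c d : (c <= d)%N -> s c <= s d.
  move=> cd; rewrite -(subnKC cd); elim: (d - c)%N => [|k IH]; first by rewrite addn0.
  by rewrite addnS sS; have := w_gt0 (c + k)%N; lra.
have s_arc c d : (c <= d)%N -> \sum_(c <= i < d) w i = s d - s c.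
  by move=> cd; rewrite /s (@big_cat_nat _ _ _ c 0 d) //= [RHS]addrC addKr.
have s0 : s 0%N = 0 by rewrite /s big_geq.
have s_range c : (c <= N)%N -> 0 <= s c <= s N by move=> cN; rewrite -[0]s0 !s_mono.
pose idx x := val ((v^-1)%g x).
have idxK i : (i < N)%N -> idx (vtx v i) = i.
  by move=> iN; rewrite /idx /vtx permK /= modn_small.
(* Embedding the polygon isometrically in a circle of length [s N] makes the
   distance from [a] a 1-Lipschitz potential. *)
pose f x := circle_dist (s N) (s a) (s (idx x)).
(* For [i = m.+1] the next vertex sits at arc length [0], whereas [s i + w i] is the full length
   [s N]. *)
have fS i : (i < N)%N -> f (vtx v i.+1) = circle_dist (s N) (s a) (s i + w i).
  move=> iN; rewrite /f -sS; have [iE|iE] := eqVneq i m.+1; last by rewrite idxK //; lia.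
  have -> : idx (vtx v i.+1) = 0%N by rewrite iE -[m.+2]add0n vtx_period idxK.
  by rewrite s0 iE circle_dist_wrap // s_range //; lia.
have lip y z : adj G y z -> f z <= f y + wt G [set y; z].
  rewrite /adj /= Gv => /polygon_edgesP [i iN E]; rewrite E -/(w i).
  have [||||up down] := @circle_dist_step R (s N) (s a) (s i) (w i).
  - by apply: s_range; lia.
  - by have /andP [] := s_range i (ltnW iN).
  - exact: ltW.
  - by rewrite -sS; apply: s_mono.
  have fi : f (vtx v i) = circle_dist (s N) (s a) (s i) by rewrite /f idxK.
  by case: (set2_inj E) => [] [-> ->]; rewrite fS // fi.
have := potential_le lip; case/and3P: pp => pth _ /eqP lp => /(_ _ _ pth).
rewrite lp pw {1 2}/f !idxK //; last by lia.
have sab : s a <= s b by apply: s_mono; lia.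
have sN0 : Num.min 0 (s N) = 0 by apply/min_idPl; case/andP: (s_range N (leqnn _)).
rewrite /circle_dist subrr normr0 subr0 sN0 add0r.
rewrite ler0_norm ?subr_le0 // opprB -s_arc //; last exact: ltnW.
congr (Num.min _ _ <= _).
have := sum_arc_wrap a wN bN; have := s_arc b N (ltnW bN); have := s_arc a b (ltnW ab).
by rewrite -/(s a) => -> -> ->; lra.
Qed.

End Distances.

(** * Sufficient conditions *)

Section Realizability.
Context {R : realType} {m : nat}.
Local Notation N := m.+2.
Context (D : {set 'I_N} -> R) (D_gt0 : forall I : {set 'I_N}, #|I| = 2%N -> 0 < D I).
Context (D_triangle : forall i j k : 'I_N, i != j -> i != k -> j != k ->
  D [set i; j] <= D [set i; k] + D [set k; j]).
Implicit Types (G : wgraph R N) (v : {perm 'I_N}) (x y z : 'I_N).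

Lemma polygonlike_of_arcs v :
    (forall a b, (a < b < N)%N ->
       let w i := D [set vtx v i; vtx v i.+1] in
       \sum_(a <= i < b) w i <= D [set vtx v a; vtx v b] \/
       \sum_(b <= i < a + N) w i <= D [set vtx v a; vtx v b]) ->
  polygonlike D.
Proof.
move=> arcs; exists (metric_graph D_gt0 (@polygon_edges_card2 _ v)); first by exists v.
apply: metric_graph_realizes => //.
apply: (vtx_neq_sym (v := v)) => [x y|a b ab].
  by rewrite setUC; apply: (ex_path_rev (P := fun r => r <= _)).
have [le_ab|le_ba] := arcs _ _ ab.
  have [||p pp pw] := @arc_path _ _ (metric_graph D_gt0 (@polygon_edges_card2 _ v)) v a b.
  - by [].
  - by lia.
  by exists p; rewrite ?pw.
apply: (ex_path_rev (P := fun r => r <= _)).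
have [||p pp pw] := @arc_path _ _ (metric_graph D_gt0 (@polygon_edges_card2 _ v)) v b (a + N).
- by [].
- by lia.
by rewrite vtx_period in pp; exists p; rewrite ?pw.
Qed.

(** Number the vertices along the Hamiltonian path. For an edge of the snake with later endpoint
    [z], [acyclic_chord] makes the other endpoint the predecessor of [z], so the edge belongs to the
    polygon. *)
Lemma snakelike_polygonlike : snakelike D -> polygonlike D.
Proof.
move=> [G snake rG]; have ac : acyclic G by case: snake => [[]].
have [x [p [pth u cover]]] := snake_hamiltonian_path snake.
have szp : size (x :: p) = N.
  by rewrite -(card_uniqP u) -[RHS]card_ord; apply: eq_card => y; rewrite cover.
have inj : injective (fun k : 'I_N => nth x (x :: p) k).
  by move=> i j /eqP; rewrite nth_uniq ?szp // => /eqP /val_inj.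
pose v := perm inj.
exists (metric_graph D_gt0 (@polygon_edges_card2 _ v)); first by exists v.
apply: (subgraph_realizes D_gt0 D_triangle _ rG); apply/subsetP => e eG.
have /cards2P [y [z [yz eE]]] : #|e| == 2%N by rewrite (edges_card2 eG).
wlog lt_yz : y z yz eE / (index y (x :: p) < index z (x :: p))%N.
  move=> W; case: (ltngtP (index y (x :: p)) (index z (x :: p))); first exact: W.
    by apply: W; rewrite 1?eq_sym // setUC.
  by move=> /(congr1 (nth x (x :: p))); rewrite !nth_index // => E; rewrite E eqxx in yz.
have {}yz : adj G z y by rewrite /adj /= setUC -eE.
have zp : z \in p.
  have := cover z; rewrite inE => /orP [/eqP zx|//].
  by move: lt_yz; rewrite zx /= eqxx.
have [p1 [p2 pE]] : exists p1 p2, p = rcons p1 z ++ p2.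
  by case/path.splitP: zp => p1 p2; exists p1, p2.
have zN : z \notin x :: p1.
  move: u; rewrite pE cat_rcons -cat_cons cat_uniq => /and3P [_ + _].
  by apply: contra => zp1; apply/hasP; exists z; rewrite ?mem_head.
have iz : index z (x :: p) = (size p1).+1.
  by rewrite pE cat_rcons -cat_cons index_cat (negPf zN) /= eqxx addn0.
have yp1 : y \in x :: p1.
  apply: contraTT lt_yz => yN; rewrite -leqNgt iz pE cat_rcons -cat_cons index_cat (negPf yN).
  by rewrite /= leq_addr.
have yl : y = last x p1.
  apply: acyclic_chord ac _ _ yp1 yz.
    by move: pth; rewrite pE cat_path => /andP [].
  by move: u; rewrite pE -cat_cons cat_uniq => /and3P [].
have p1N : (size p1 < m.+1)%N.
  by move: szp; rewrite pE /= size_cat size_rcons; lia.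
have -> : e = [set vtx v (size p1); vtx v (size p1).+1].
  rewrite eE /vtx !permE /= !modn_small //; last exact: ltnW.
  have -> : nth x (x :: p) (size p1).+1 = z by rewrite -iz nth_index.
  rewrite pE cat_rcons -cat_cons nth_cat /= ltnS leqnn.
  by rewrite -[size p1]/((size (x :: p1)).-1) nth_last yl.
exact: vtx_edge.
Qed.

(** Indices stop at [m], leaving out the step from [m.+1] back to [0] that closes the polygon. *)
Definition arc_edges v : {set {set 'I_N}} :=
  [set [set vtx v i; vtx v i.+1] | i : 'I_m.+1].

Lemma arc_edges_card2 v e : e \in arc_edges v -> #|e| = 2%N.
Proof. by move=> /imsetP [i _ ->]; apply/polygon_edges_card2/vtx_edge. Qed.

Lemma arc_edges_vtx v i j : (i < N)%N -> (j < N)%N ->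
  ([set vtx v i; vtx v j] \in arc_edges v) = (j == i.+1) || (i == j.+1).
Proof.
have inj a b : (a < N)%N -> (b < N)%N -> vtx v a = vtx v b -> a = b.
  by move=> aN bN; apply: (@vtx_inj _ v 0 m.+1); lia.
move=> iN jN; apply/imsetP/orP => [[k _ /set2_inj [] [E1 E2]]|[] /eqP E].
- have kN := ltn_ord k; left; apply/eqP.
  by rewrite (inj _ _ iN _ E1) 1?(inj _ _ jN _ E2) //; exact: ltnW.
- have kN := ltn_ord k; right; apply/eqP.
  by rewrite (inj _ _ iN _ E1) 1?(inj _ _ jN _ E2) //; exact: ltnW.
- have im : (i < m.+1)%N by lia.
  by exists (Ordinal im); rewrite // E.
- have jm : (j < m.+1)%N by lia.
  by exists (Ordinal jm); rewrite // E setUC.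
Qed.

Lemma arc_is_snake G v : edges G = arc_edges v -> is_snake G.
Proof.
move=> Gv; pose idx x := val ((v^-1)%g x).
have idxN x : (idx x < N)%N by apply: ltn_ord.
have idxK x : vtx v (idx x) = x by rewrite vtx_val permKV.
have vtxK i : (i < N)%N -> idx (vtx v i) = i.
  by move=> iN; rewrite /idx /vtx permK /= modn_small.
have adjE x y : adj G x y = (idx y == (idx x).+1) || (idx x == (idx y).+1).
  by rewrite -(arc_edges_vtx v) // !idxK /adj /= Gv.
split; first split.
- have sym : connect_sym (adj G) by apply/sym_connect_sym => x y; rewrite adjC.
  suff con0 i : (i < N)%N -> connect (adj G) (vtx v 0) (vtx v i).
    move=> x y; rewrite -(idxK x) -(idxK y); apply: connect_trans (con0 _ _) => //.
    by rewrite sym con0.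
  elim: i => // i IH iN; apply: connect_trans (IH (ltnW iN)) (connect1 _).
  by rewrite adjE !vtxK ?eqxx // ltnW.
- move=> c; case: c => // x0 c0; set c := x0 :: c0 => szc cyc.
  (* On a cycle, both neighbours of the vertex of least index would have the next index, hence
     coincide. *)
  have [x xc xmin] := @arg_minnP _ x0 (mem c) idx (mem_head _ _).
  have [i s cE] := rot_to xc.
  move: cyc szc; rewrite -(rot_ucycle i) -(size_rot i) cE.
  case: s cE => [|y s] cE //= /andP [cyc u]; case/lastP: s => // s z in cyc u cE *.
  move: cyc; rewrite /= rcons_path last_rcons => /and3P [xy _ zx] _.
  have minx t : t \in x :: y :: rcons s z -> (idx x <= idx t)%N.
    by rewrite -cE mem_rot; apply: xmin.
  have := minx y; have := minx z; rewrite !inE mem_rcons !inE !eqxx !orbT => /(_ isT) lz /(_ isT) ly.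
  move: xy zx; rewrite !adjE => xy zx.
  have yz : y = z by rewrite -(idxK y) -(idxK z); congr (vtx v _); lia.
  by move: u; rewrite yz /= mem_rcons mem_head !andbF.
(* A vertex strictly between the two ends has both a predecessor and a successor, so it is no
   leaf. *)
have -> : [set x | is_leaf G x] = [set vtx v 0; vtx v m.+1].
  apply/setP => x; rewrite !inE; apply/is_leafP/orP => [[y xy yu]|[] /eqP ->].
  - have [x0|x0] := posnP (idx x); first by left; rewrite -[x]idxK x0.
    have [xm|xm] := eqVneq (idx x) m.+1; first by right; rewrite -[x]idxK xm.
    have xN := idxN x.
    have iN1 : ((idx x).-1 < N)%N by lia.
    have iN2 : ((idx x).+1 < N)%N by lia.
    have E1 : vtx v (idx x).-1 = y by apply: yu; rewrite adjE vtxK //; apply/orP; lia.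
    have : vtx v (idx x).+1 = y by apply: yu; rewrite adjE vtxK //; apply/orP; lia.
    by rewrite -E1 => /(congr1 idx); rewrite !vtxK // ; lia.
  - exists (vtx v 1); first by rewrite adjE !vtxK.
    by move=> z; rewrite adjE vtxK // => H; rewrite -(idxK z); congr (vtx v _); lia.
  - exists (vtx v m); first by rewrite adjE !vtxK ?eqxx ?orbT.
    move=> z; have zN := idxN z; rewrite adjE vtxK // => H; rewrite -(idxK z).
    by congr (vtx v _); lia.
rewrite cards2; case: eqP => // /(congr1 idx); rewrite !vtxK //; lia.
Qed.

Lemma snakelike_of_arc v :
    (forall a b, (a < b < N)%N ->
       \sum_(a <= i < b) D [set vtx v i; vtx v i.+1] <= D [set vtx v a; vtx v b]) ->
  snakelike D.
Proof.
move=> arc; exists (metric_graph D_gt0 (@arc_edges_card2 v)); first exact: arc_is_snake.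
apply: metric_graph_realizes => //.
apply: (vtx_neq_sym (v := v)) => [x y|a b ab].
  by rewrite setUC; apply: (ex_path_rev (P := fun r => r <= _)).
have [|||p pp pw] := @window_path _ _ (metric_graph D_gt0 (@arc_edges_card2 v)) (vtx v) a b.
- by lia.
- move=> i ib; have im : (i < m.+1)%N by lia.
  by apply/imsetP; exists (Ordinal im).
- by move=> i j; apply: vtx_inj; lia.
by exists p; rewrite ?pw; first exact: pp; apply: arc.
Qed.

End Realizability.

Lemma uniq_renaming (R : realType) n (D : {set 'I_n} -> R) p q :
  p != q -> uniq (renaming D p q).
Proof.
have main k s u v : uniq s -> uniq (rename_rec D k s u v).
  elim: k s u v => //= k IH s u v us; case: next_name => [z|//].
  by case: ifP => // zs; apply: IH; rewrite rcons_uniq zs.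
by move=> pq; apply: main; rewrite /= inE pq.
Qed.

(** * Indecomposable pairs and the renaming *)

Section Renaming.
Context {R : realType} {m : nat}.
Local Notation N := m.+2.
Context (D : {set 'I_N} -> R) (D_gt0 : forall I : {set 'I_N}, #|I| = 2%N -> 0 < D I).
Context (D_triangle : forall i j k : 'I_N, i != j -> i != k -> j != k ->
  D [set i; j] <= D [set i; k] + D [set k; j]).
Implicit Types (G : wgraph R N) (v : {perm 'I_N}) (x y z p q : 'I_N).

(** Condition (iii) with names counted from 0: the closing term, for the first and last names, is
    [f 0 N.-1]. *)
Definition distance_formula (f : nat -> nat -> R) :=
  forall a b : nat, (a < b < N)%N ->
    f a b = Num.min (\sum_(a <= i < b) f i i.+1)
      (\sum_(b <= i < N.-1) f i i.+1 + f 0%N N.-1 + \sum_(0 <= i < a) f i i.+1).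

(** The renaming has no repetition, so cardinality [N] makes it a cyclic ordering of all vertices;
    the formula then says that one arc of this polygon attains each distance. *)
Lemma polygonlike_of_formula p q : p != q -> #|renamed_set D p q| = N ->
  distance_formula (renamed_family D p q) -> polygonlike D.
Proof.
move=> pq szH formula.
have us : uniq (renaming D p q) := uniq_renaming D pq.
have sz : size (renaming D p q) = N.
  by rewrite -(card_uniqP us) -[RHS]szH; apply: eq_card => x; rewrite inE.
have inj : injective (fun k : 'I_N => nth p (renaming D p q) k).
  by move=> i j /eqP; rewrite nth_uniq ?sz // => /eqP /val_inj.
pose v := perm inj.
have vtxE i : (i < N)%N -> vtx v i = nth p (renaming D p q) i.
  by move=> iN; rewrite /vtx permE /= modn_small.
have fE i : (i < m.+1)%N -> renamed_family D p q i i.+1 = D [set vtx v i; vtx v i.+1].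
  by move=> im; rewrite !vtxE // ltnW.
apply: (polygonlike_of_arcs D_gt0 D_triangle (v := v)) => a b /andP [ab bN] w.
have wN i : w (i + N) = w i by rewrite /w -addSn !vtx_period.
have := formula a b; rewrite ab bN => /(_ isT).
rewrite {1}/renamed_family -!vtxE ?(ltn_trans ab) // => ->.
have E1 c d : (d <= m.+1)%N ->
    \sum_(c <= i < d) renamed_family D p q i i.+1 = \sum_(c <= i < d) w i.
  by move=> dm; apply: eq_big_nat => i /andP [_ id]; rewrite fE //; lia.
have E2 : renamed_family D p q 0 m.+1 = w m.+1.
  by rewrite /w (vtx_period v 0) setUC !vtxE.
rewrite (sum_arc_wrap a wN bN) (@big_nat_recr _ _ _ m.+1 b) //=.
rewrite E2 (E1 a b) // (E1 b) // (E1 0%N a); last by lia.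
have key (A B : R) : A <= Num.min A B \/ B <= Num.min A B.
  by case: (leP A B) => _; [left|right].
exact: key.
Qed.

(** Centring at [i.+1] lets both neighbours have natural indices, with no predecessor modulo [N]. *)
Lemma polygon_neighbor v i z : [set vtx v i.+1; z] \in polygon_edges v ->
  z = vtx v i \/ z = vtx v i.+2.
Proof.
rewrite /vtx; move=> /imsetP [k _ /set2_inj [] [/perm_inj ik ->]].
  by right; rewrite -ik ordS_inZp.
by left; move: ik; rewrite -ordS_inZp => /ordS_inj ->.
Qed.

(** * The renaming when the indecomposable pairs are the polygon edges *)

Section PolygonIndecomposables.
(** With at least three vertices, the two neighbours of a vertex are distinct. *)
Context (v : {perm 'I_N}) (m_gt0 : (0 < m)%N).
Context (indE : forall x y, x != y -> indecomposable D x y = ([set x; y] \in polygon_edges v)).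

Lemma vtx_neq i j : (i < j < i + N)%N -> vtx v i != vtx v j.
Proof. by move=> ij; apply/eqP => /(@vtx_inj _ v i j); lia. Qed.

Lemma indecomposable_vtx i : indecomposable D (vtx v i.+1) (vtx v i.+2).
Proof. by rewrite indE ?vtx_edge // vtx_neq //; lia. Qed.

Lemma next_name_vtx i : next_name D (vtx v i) (vtx v i.+1) = Some (vtx v i.+2).
Proof.
rewrite /next_name; case: pickP => [z /and3P [zi zi1]|/(_ (vtx v i.+2))].
  by rewrite indE 1?eq_sym // => /polygon_neighbor [zE|-> //]; rewrite zE eqxx in zi.
by rewrite indecomposable_vtx !(eq_sym (vtx v i.+2)) !vtx_neq //; lia.
Qed.

Lemma renaming_vtx : renaming D (vtx v 0) (vtx v 1) = [seq vtx v i | i <- iota 0 N].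
Proof.
rewrite /renaming -[[:: _; _]]/[seq vtx v i | i <- iota 0 2].
(* After [k.+2] vertices have been listed, the fuel bound still leaves a round to detect the return
   to [vtx v 0]. *)
have main fuel k : (k.+2 <= N)%N -> (N <= fuel + k.+1)%N ->
    rename_rec D fuel [seq vtx v i | i <- iota 0 k.+2] (vtx v k) (vtx v k.+1) =
    [seq vtx v i | i <- iota 0 N].
  elim: fuel k => [|fuel IH] k kN fN; first lia.
  rewrite /= next_name_vtx -[vtx v 0 :: _]/[seq vtx v i | i <- iota 0 k.+2].
  (* At [k = m] the next vertex has index [N], that is [vtx v 0], already listed: the walk stops. *)
  have [kE|kE] := eqVneq k m.
    by rewrite kE (vtx_period v 0) inE eqxx.
  rewrite ifN; last first.
    apply/negP => /mapP [j]; rewrite mem_iota => jk /(@vtx_inj _ v 0 k.+2); lia.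
  have := IH k.+1; rewrite -(addn1 k.+2) iotaD map_cat cats1; apply; lia.
by apply: (main N 0%N); lia.
Qed.

Lemma card_indec_partners x : #|indec_partners D x| = 2%N.
Proof.
have [i ->] : exists i, x = vtx v i.+1.
  (* The index [a + m.+1] is [a - 1] modulo [N]. *)
  have [a _ ->] := vtx_surj v x; exists (a + m.+1)%N.
  by rewrite -addnS vtx_period.
suff -> : indec_partners D (vtx v i.+1) = [set vtx v i; vtx v i.+2].
  by rewrite cards2 vtx_neq //; lia.
apply/setP => z; rewrite !inE; apply/andP/orP => [[zi]|[] /eqP ->].
- by rewrite indE 1?eq_sym // => /polygon_neighbor [] ->; rewrite eqxx; [left|right].
- have ne : vtx v i != vtx v i.+1 by rewrite vtx_neq //; lia.
  by rewrite ne indE 1?eq_sym // setUC vtx_edge.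
- by rewrite eq_sym vtx_neq ?indecomposable_vtx //; lia.
Qed.

End PolygonIndecomposables.

Definition edge_weight G v i := wt G [set vtx v i; vtx v i.+1].

(** Only the closing edge is treated, since [polygon_basepoint] can move any edge there. Being
    lighter than all the others together, it is the shorter arc between its ends. *)
Lemma light_edge_indecomposable G v :
    edges G = polygon_edges v -> realizes D G ->
    edge_weight G v m.+1 < \sum_(0 <= i < m.+1) edge_weight G v i ->
  indecomposable D (vtx v m.+1) (vtx v 0) /\
  D [set vtx v m.+1; vtx v 0] = edge_weight G v m.+1.
Proof.
move=> Gv rG light.
have w_gt0 i : 0 < edge_weight G v i by apply: wt_gt0; rewrite Gv; apply: vtx_edge.
have wN i : edge_weight G v (i + N) = edge_weight G v i.
  by rewrite /edge_weight -addSn !vtx_period.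
have dist a b : (a < b < N)%N -> D [set vtx v a; vtx v b] =
    Num.min (\sum_(a <= i < b) edge_weight G v i)
     (\sum_(b <= i < m.+1) edge_weight G v i + edge_weight G v m.+1 +
      \sum_(0 <= i < a) edge_weight G v i).
  move=> ab; rewrite (polygon_distance Gv rG ab); congr Num.min.
  have := sum_arc_wrap a wN (_ : b < N)%N.
  by case/andP: (ab) => _ bN /(_ bN) ->; rewrite big_nat_recr.
have D0 : D [set vtx v m.+1; vtx v 0] = edge_weight G v m.+1.
  rewrite setUC dist ?ltnSn // (@big_geq _ _ _ m.+1 m.+1) // (@big_geq _ _ _ 0%N 0%N) // add0r addr0.
  by apply/min_idPr/ltW.
split=> //; apply/forallP => z; apply/implyP => /andP [zm z0]; rewrite D0.
have [b bN zE] := vtx_surj v z.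
have b0 : (0 < b)%N by case: b zE bN z0 => // ->; rewrite eqxx.
have bm : (b < m.+1)%N.
  by case: (ltngtP b m.+1) bN => // [|bE] ; [lia|rewrite zE bE eqxx in zm].
rewrite zE setUC dist ?bm ?ltnSn // [in X in _ + X]setUC dist ?b0 //.
rewrite (@big_geq _ _ _ m.+1 m.+1) // (@big_geq _ _ _ 0%N 0%N) // addr0 add0r.
move: light; rewrite (@big_cat_nat _ _ _ b) ?(ltnW bm) //=.
have pos c d : (c < d)%N -> 0 < \sum_(c <= i < d) edge_weight G v i.
  move=> cd; rewrite big_ltn // ltr_wpDr // sumr_ge0 // => i _; exact: ltW.
have := pos _ _ b0; have := pos _ _ bm; have := w_gt0 m.+1.
move: (\sum_(0 <= i < b) _) (\sum_(b <= i < m.+1) _) (edge_weight G v m.+1) => A B w ? ? ? ?.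
(* Of the four possible sums, [A + B] exceeds [w] by lightness, and the others contain [w] plus
   positive terms. *)
case: (min_cases B (w + A)) => -[-> ?]; case: (min_cases A (B + w)) => -[-> ?]; lra.
Qed.

(** A detour through [z] contains the pair [z], [q], already at least the minimum, plus a positive
    term. *)
Lemma min_pair_indecomposable p q : is_min_pair D p q -> indecomposable D p q.
Proof.
move=> [pq min]; apply/forallP => z; apply/implyP => /andP [zp zq].
apply: (le_lt_trans (min _ _ zq)); rewrite ltrDr D_gt0 // cards2 eq_sym zp //.
Qed.

Lemma polygonlike_necessary p q : is_min_pair D p q -> polygonlike D ->
  snakelike D \/
  [/\ forall i, #|indec_partners D i| = 2%N, #|renamed_set D p q| = N
    & distance_formula (renamed_family D p q)].
Proof.
move=> pq_min [G [v Gv] rG]; have pq : p != q by case: pq_min.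
have {}Gv : edges G = polygon_edges v := Gv.
(* Letting [v'] range over all numberings of the same polygon tests every edge in the closing
   position. *)
pose heavy (v' : {perm 'I_N}) :=
  (edges G == polygon_edges v') &&
  (\sum_(0 <= i < m.+1) edge_weight G v' i <= edge_weight G v' m.+1).
have [/existsP [v' /andP [/eqP Gv' hv']]|light] := boolP [exists v', heavy v'].
  left; apply: (snakelike_of_arc D_gt0 D_triangle (v := v')) => a b ab.
  have w_gt0 i : 0 < edge_weight G v' i by apply: wt_gt0; rewrite Gv'; apply: vtx_edge.
  have wN i : edge_weight G v' (i + N) = edge_weight G v' i.
    by rewrite /edge_weight -addSn !vtx_period.
  have pos c d : 0 <= \sum_(c <= i < d) edge_weight G v' i.
    by rewrite sumr_ge0 // => i _; apply: ltW.
  case/andP: (ab) => lt_ab bN.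
  rewrite (polygon_distance Gv' rG ab).
  apply: le_trans (_ : \sum_(a <= i < b) edge_weight G v' i <= _).
    apply: ler_sum => i _; apply: (realizes_edge_le rG); rewrite Gv'; exact: vtx_edge.
  (* The other arc contains the heavy closing edge, so it weighs at least as much as the arc from
     [a] to [b]. *)
  rewrite le_min lexx /=; have /= -> := sum_arc_wrap a wN bN.
  rewrite big_nat_recr //=.
  move: hv'; rewrite (@big_cat_nat _ _ _ a) //=; last by lia.
  rewrite (@big_cat_nat _ _ _ b a m.+1) //=; last by lia.
  have := pos b m.+1; have := pos 0%N a; lra.
right.
have {}light v' : edges G = polygon_edges v' ->
    edge_weight G v' m.+1 < \sum_(0 <= i < m.+1) edge_weight G v' i.
  move=> /eqP Gv'; move: light; rewrite negb_exists => /forallP /(_ v').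
  by rewrite /heavy Gv' /= -ltNge.
(* With two vertices, the indices [0] and [1] give the same edge, which cannot be lighter than
   itself. *)
have m_gt0 : (0 < m)%N.
  rewrite lt0n; apply/eqP => m0; have := light v Gv; rewrite m0 big_nat1 /edge_weight.
  have -> : vtx v 2 = vtx v 0 by congr (v _); apply: val_inj; rewrite /= m0.
  by rewrite setUC ltxx.
have edge_tight x y : [set x; y] \in polygon_edges v ->
    indecomposable D x y /\ D [set x; y] = wt G [set x; y].
  move=> /(polygon_basepoint (inZp m.+1)) [v' [Ev' <- <-]].
  rewrite ordS_inZp -/(vtx v' _) -/(vtx v' _).
  have Gv' : edges G = polygon_edges v' by rewrite Ev'.
  have [] := light_edge_indecomposable Gv' rG (light _ Gv').
  by rewrite -(vtx_period v' 0).
have indE x y : x != y -> indecomposable D x y = ([set x; y] \in polygon_edges v).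
  move=> xy; apply/idP/idP => [|/edge_tight [] //].
  by move=> /(indecomposable_adj rG xy); rewrite /adj /= Gv.
have := min_pair_indecomposable pq_min; rewrite indE //.
(* Renumber so that [p] and [q] have indices [0] and [1], where the renaming starts. *)
move=> /(polygon_basepoint ord0) [v' [Ev' v'0 v'1]].
have {}indE x y : x != y -> indecomposable D x y = ([set x; y] \in polygon_edges v').
  by rewrite Ev'; apply: indE.
have {}Gv : edges G = polygon_edges v' by rewrite Ev'.
have renE : renaming D p q = [seq vtx v' i | i <- iota 0 N].
  by rewrite -renaming_vtx // -v'0 -v'1 -!vtx_val.
have nthE i : (i < N)%N -> nth p (renaming D p q) i = vtx v' i.
  by move=> iN; rewrite renE (nth_map 0%N) ?size_iota // nth_iota.
split; first by move=> i; apply: (card_indec_partners m_gt0 indE).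
- rewrite -[RHS](size_iota 0 N) -(size_map (vtx v')) -renE.
  rewrite -(card_uniqP (uniq_renaming D pq)); apply: eq_card => x; by rewrite inE.
- move=> a b ab; case/andP: (ab) => lt_ab bN.
  have fE i : (i < m.+1)%N -> renamed_family D p q i i.+1 = edge_weight G v' i.
    move=> im; rewrite /renamed_family !nthE //; last exact: ltnW.
    by case: (edge_tight (vtx v' i) (vtx v' i.+1)) => //; rewrite -Ev' vtx_edge.
  have f0 : renamed_family D p q 0 m.+1 = edge_weight G v' m.+1.
    rewrite /renamed_family !nthE // setUC -(vtx_period v' 0).
    by case: (edge_tight (vtx v' m.+1) (vtx v' m.+2)) => //; rewrite -Ev' vtx_edge.
  have E1 c d : (d <= m.+1)%N ->
      \sum_(c <= i < d) renamed_family D p q i i.+1 = \sum_(c <= i < d) edge_weight G v' i.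
    by move=> dm; apply: eq_big_nat => i /andP [_ id]; rewrite fE //; lia.
  have wN i : edge_weight G v' (i + N) = edge_weight G v' i.
    by rewrite /edge_weight -addSn !vtx_period.
  rewrite {1}/renamed_family !nthE ?(ltn_trans lt_ab) //.
  rewrite (polygon_distance Gv rG ab) /= !E1 ?f0; try lia.
  by have /= -> := sum_arc_wrap a wN bN; rewrite big_nat_recr.
Qed.

End Renaming.

Theorem theorem4p4 (R : realType) (n : nat) (D : {set 'I_n} -> R)
    (D_gt0 : forall I : {set 'I_n}, #|I| = 2%N -> 0 < D I)
    (D_triangle : forall i j k : 'I_n, i != j -> i != k -> j != k ->
       D [set i; j] <= D [set i; k] + D [set k; j])
    (p q : 'I_n) (pq_min : is_min_pair D p q) :
  polygonlike D <->
  snakelike D \/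
  [/\ forall i : 'I_n, #|indec_partners D i| = 2%N,
      #|renamed_set D p q| = n
    & let D' := renamed_family D p q in
      forall a b : nat, (a < b < n)%N ->
        D' a b = Num.min (\sum_(a <= i < b) D' i i.+1)
                         (\sum_(b <= i < n.-1) D' i i.+1 + D' 0%N n.-1
                            + \sum_(0 <= i < a) D' i i.+1)].
Proof.
(* For [n < 2] there are no two distinct elements [p] and [q]. *)
case: n D D_gt0 D_triangle p q pq_min => [|[|m]] D D_gt0 D_triangle p q pq_min.
- by case: p pq_min.
- by case: pq_min => /eqP []; rewrite !ord1.
split; first exact: polygonlike_necessary.
move=> [/snakelike_polygonlike|[_ szH formula]]; first exact.
by case: pq_min => pq _; apply: (polygonlike_of_formula _ _ pq szH formula).
Qed.
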